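(* Let $\mathfrak g$ be a $2$-step solvable Lie algebra endowed with a simple complex structure $J$. Then either $\mathfrak g\simeq\mathfrak{aff}(\mathbb R)$ or $\mathfrak g\simeq\mathfrak{aff}(\mathbb C)$.
   Context: All Lie algebras are finite-dimensional and real. A complex structure on $\mathfrak g$ is $J\in\mathrm{End}(\mathfrak g)$ with $J^2=-\mathrm{Id}$ and $[X,Y]+J[JX,Y]+J[X,JY]-[JX,JY]=0$ for all $X,Y$. $2$-step solvable means $[\mathfrak g',\mathfrak g']=0$, where $\mathfrak g'=[\mathfrak g,\mathfrak g]$. $J$ is simple if $\mathfrak g$ is not abelian and has no $J$-invariant ideals other than $0$ and $\mathfrak g$. The symbol $\simeq$ means holomorphically isomorphic, i.e. there is a Lie algebra isomorphism commuting with the complex structures. $\mathfrak{aff}(\mathbb R)$ is the $2$-dimensional Lie algebra with basis $X,JX$ and $[JX,X]=X$. $\mathfrak{aff}(\mathbb C)$ is the $4$-dimensional real Lie algebra with basis $X,JX,Y,JY$ and brackets $[JX,X]=X$, $[JX,Y]=[JY,X]=Y$, $[JY,Y]=-X$, $[X,Y]=[JX,JY]=0$. Both are equipped with the complex structure $J$ indicated by the notation. *)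

(* Defs.v *)
From HB Require Import structures.
From mathcomp Require Import all_boot all_order all_algebra.
From mathcomp Require Import reals ring.

Set Implicit Arguments.
Unset Strict Implicit.
Unset Printing Implicit Defensive.

Import GRing.Theory.
Local Open Scope ring_scope.

Reserved Notation "[lie x , y ]" (format "[lie  x ,  y ]").

(* Finite-dimensional Lie algebras over R: the Vector structure is what *)
(* imposes finite dimension.                                            *)
HB.mixin Record isLieAlgebra (R : realType) L of Vector R L := {
  lie_bracket : L -> L -> L;
  lie_bilinear : bilinear_for *:%R *:%R lie_bracket;
  lie_alternating : forall x, lie_bracket x x = 0;
  lie_jacobi : forall x y z,
    lie_bracket x (lie_bracket y z) + lie_bracket y (lie_bracket z x)
      + lie_bracket z (lie_bracket x y) = 0
}.

#[short(type="lieAlgType")]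
HB.structure Definition LieAlgebra (R : realType) :=
  { L of isLieAlgebra R L & Vector R L }.

Notation "[lie x , y ]" := (lie_bracket x y) : ring_scope.

Section LieAlgebraTheory.
Variables (R : realType) (g : lieAlgType R).
Implicit Types (U V W I : {vspace g}) (J : 'End(g)).

(* By bilinearity, brackets of basis vectors span [U, V]: see lie_prodvP. *)
Definition lie_prodv U V : {vspace g} :=
  <<[seq [lie x, y] | x <- vbasis U, y <- vbasis V]>>%VS.

Definition derived_subalgebra : {vspace g} := lie_prodv fullv fullv.

Definition abelian_lie := forall x y : g, [lie x, y] = 0.

Definition two_step_solvable :=
  lie_prodv derived_subalgebra derived_subalgebra = 0%VS.

Definition lie_ideal I := forall x y : g, y \in I -> [lie x, y] \in I.

Definition complex_structure J :=
  (forall x, J (J x) = - x) /\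
  (forall x y,
     [lie x, y] + J [lie J x, y] + J [lie x, J y] - [lie J x, J y] = 0).

Definition simple_complex_structure J :=
  [/\ complex_structure J, ~ abelian_lie &
      forall I, lie_ideal I -> (J @: I <= I)%VS -> I = 0%VS \/ I = fullv].

HB.instance Definition _ := bilinear_isBilinear.Build R g g g _ _
  (@lie_bracket R g) lie_bilinear.

Lemma memv_lie U V x y : x \in U -> y \in V -> [lie x, y] \in lie_prodv U V.
Proof.
move=> Ux Vy; rewrite (coord_vbasis Ux) linear_sumlz memv_suml // => i _.
rewrite (coord_vbasis Vy) linear_sumr memv_suml // => j _.
rewrite linearZl_LR linearZr_LR !memvZ // memv_span //.
by apply: allpairs_f; rewrite mem_nth ?size_tuple.
Qed.

Lemma lie_prodvP U V W :
  reflect (forall x y, x \in U -> y \in V -> [lie x, y] \in W)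
          (lie_prodv U V <= W)%VS.
Proof.
apply: (iffP idP) => [/subvP sUVW x y Ux Vy | sUVW].
  exact/sUVW/memv_lie.
apply/span_subvP=> _ /allpairsP[[x y] /= [Ux Vy ->]].
by apply: sUVW; exact: vbasis_mem.
Qed.

End LieAlgebraTheory.

Arguments two_step_solvable {R} g.
Arguments derived_subalgebra {R} g.
Arguments abelian_lie {R} g.

Definition holomorphically_isomorphic (R : realType) (g h : lieAlgType R)
    (Jg : 'End(g)) (Jh : 'End(h)) :=
  exists f : 'Hom(g, h),
    [/\ bijective f,
        forall x y, f [lie x, y] = [lie f x, f y] &
        forall x, f (Jg x) = Jh (f x)].

(* aff(R): row vectors of coordinates in the basis (X, JX). *)
Section AffR.
Variable R : realType.

Definition affR : Type := 'rV[R]_2.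
HB.instance Definition _ := Vector.on affR.

Definition affR_X : affR := delta_mx 0 0.
Definition affR_JX : affR := delta_mx 0 1.

Definition affR_bracket (u v : affR) : affR :=
  (u 0 1 * v 0 0 - u 0 0 * v 0 1) *: affR_X.

Fact affR_bilinear : bilinear_for *:%R *:%R affR_bracket.
Proof.
by split=> w a u v; apply/rowP=> i; rewrite !mxE; ring.
Qed.

Fact affR_alternating u : affR_bracket u u = 0.
Proof. by apply/rowP=> i; rewrite !mxE; ring. Qed.

Fact affR_jacobi u v w :
  affR_bracket u (affR_bracket v w) + affR_bracket v (affR_bracket w u)
    + affR_bracket w (affR_bracket u v) = 0.
Proof. by apply/rowP=> i; rewrite !mxE /=; ring. Qed.

HB.instance Definition _ :=
  isLieAlgebra.Build R affR affR_bilinear affR_alternating affR_jacobi.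

Definition affR_J : 'End(affR) :=
  linfun (mulmxr (delta_mx 0 1 - delta_mx 1 0) : affR -> affR).

Lemma affR_table : [lie affR_JX, affR_X] = affR_X.
Proof. by apply/rowP=> i; rewrite !mxE /=; ring. Qed.

Lemma affR_JE : affR_J affR_X = affR_JX /\ affR_J affR_JX = - affR_X.
Proof.
by split; rewrite lfunE /= mulmxBr ?mul_delta_mx ?mul_delta_mx_0 ?subr0 ?sub0r.
Qed.

Lemma affR_J_complex : complex_structure affR_J.
Proof.
have uE (u : affR) : u = u 0 0 *: affR_X + u 0 1 *: affR_JX.
  rewrite {1}[u]row_sum_delta !big_ord_recl big_ord0 addr0.
  by have -> : lift ord0 ord0 = 1 :> 'I_2 by exact/val_inj.
have [JX JJX] := affR_JE.
have JE (u : affR) : affR_J u = u 0 0 *: affR_JX - u 0 1 *: affR_X.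
  by rewrite {1}[u]uE linearD !linearZ /= JX JJX scalerN.
split=> [u|u v].
  by rewrite !JE [in RHS](uE u); apply/rowP=> i; rewrite !mxE /=; ring.
by rewrite !JE; apply/rowP=> i; rewrite !mxE /=; ring.
Qed.

End AffR.

(* aff(C): row vectors of coordinates in the basis (X, JX, Y, JY). *)
Section AffC.
Variable R : realType.

Definition affC : Type := 'rV[R]_4.
HB.instance Definition _ := Vector.on affC.

Definition affC_X : affC := delta_mx 0 0.
Definition affC_JX : affC := delta_mx 0 1.
Definition affC_Y : affC := delta_mx 0 2.
Definition affC_JY : affC := delta_mx 0 3.

Definition affC_bracket (u v : affC) : affC :=
  ((u 0 1 * v 0 0 - u 0 0 * v 0 1) - (u 0 3 * v 0 2 - u 0 2 * v 0 3))
    *: affC_X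
  + ((u 0 1 * v 0 2 - u 0 2 * v 0 1) + (u 0 3 * v 0 0 - u 0 0 * v 0 3))
    *: affC_Y.

Fact affC_bilinear : bilinear_for *:%R *:%R affC_bracket.
Proof.
by split=> w a u v; apply/rowP=> i; rewrite !mxE; ring.
Qed.

Fact affC_alternating u : affC_bracket u u = 0.
Proof. by apply/rowP=> i; rewrite !mxE; ring. Qed.

Fact affC_jacobi u v w :
  affC_bracket u (affC_bracket v w) + affC_bracket v (affC_bracket w u)
    + affC_bracket w (affC_bracket u v) = 0.
Proof. by apply/rowP=> i; rewrite !mxE /=; ring. Qed.

HB.instance Definition _ :=
  isLieAlgebra.Build R affC affC_bilinear affC_alternating affC_jacobi.

Definition affC_J : 'End(affC) :=
  linfun (mulmxr (delta_mx 0 1 - delta_mx 1 0 + delta_mx 2 3 - delta_mx 3 2)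
          : affC -> affC).

Lemma affC_table :
  [/\ [lie affC_JX, affC_X] = affC_X,
      [lie affC_JX, affC_Y] = affC_Y /\ [lie affC_JY, affC_X] = affC_Y,
      [lie affC_JY, affC_Y] = - affC_X,
      [lie affC_X, affC_Y] = 0 & [lie affC_JX, affC_JY] = 0].
Proof. by split; [|split| | |]; apply/rowP=> i; rewrite !mxE /=; ring. Qed.

Lemma affC_JE :
  [/\ affC_J affC_X = affC_JX, affC_J affC_JX = - affC_X,
      affC_J affC_Y = affC_JY & affC_J affC_JY = - affC_Y].
Proof.
by split; rewrite lfunE /= !(mulmxBr, mulmxDr) ?mul_delta_mx ?mul_delta_mx_0
  ?(subr0, sub0r, addr0, add0r, oppr0).
Qed.

Lemma affC_J_complex : complex_structure affC_J.
Proof.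
have uE (u : affC) : u = u 0 0 *: affC_X + u 0 1 *: affC_JX
    + u 0 2 *: affC_Y + u 0 3 *: affC_JY.
  rewrite {1}[u]row_sum_delta !big_ord_recl big_ord0 addr0 !addrA.
  have -> : lift ord0 ord0 = 1 :> 'I_4 by exact/val_inj.
  have -> : lift ord0 (lift ord0 ord0) = 2 :> 'I_4 by exact/val_inj.
  by have -> : lift ord0 (lift ord0 (lift ord0 ord0)) = 3 :> 'I_4
    by exact/val_inj.
have [JX JJX JY JJY] := affC_JE.
have JE (u : affC) : affC_J u =
    u 0 0 *: affC_JX - u 0 1 *: affC_X + u 0 2 *: affC_JY - u 0 3 *: affC_Y.
  by rewrite {1}[u]uE !linearD !linearZ /= JX JJX JY JJY !scalerN.
split=> [u|u v].
  by rewrite !JE [in RHS](uE u); apply/rowP=> i; rewrite !mxE /=; ring.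
have J0 w : (affC_J w) 0 0 = - w 0 1 by rewrite JE !mxE /=; ring.
have J1 w : (affC_J w) 0 1 = w 0 0 by rewrite JE !mxE /=; ring.
have J2 w : (affC_J w) 0 2 = - w 0 3 by rewrite JE !mxE /=; ring.
have J3 w : (affC_J w) 0 3 = w 0 2 by rewrite JE !mxE /=; ring.
have JL a b : affC_J (a *: affC_X + b *: affC_Y) = a *: affC_JX + b *: affC_JY.
  by rewrite linearD !linearZ /= JX JY.
rewrite /lie_bracket /= /affC_bracket !JL !(J0, J1, J2, J3).
by apply/rowP=> i; rewrite !mxE; ring.
Qed.

End AffC.

(* Main.v *)
(* Let A be the derived algebra. The subspaces A + JA and A :&: JA are        *)
(* J-invariant ideals, so simplicity gives g = A + JA, a direct sum.          *)
(* Integrability of J, abelianness of A and the Jacobi identity make          *)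
(* p.q := [Jp, q] a commutative associative product on A, whose ideals I      *)
(* yield the J-invariant ideals I + JI of g. Hence A is a simple commutative  *)
(* associative real algebra with nonzero product, i.e. R or C, and g is       *)
(* recovered from it by [p + Jq, p' + Jq'] = q.p' - q'.p.                     *)

Require Import Defs.
From HB Require Import structures.
From mathcomp Require Import all_boot all_order all_algebra.
From mathcomp Require Import boolp reals ring.
From mathcomp Require Import complex.

Set Implicit Arguments.
Unset Strict Implicit.
Unset Printing Implicit Defensive.

Import Order.TTheory GRing.Theory Num.Theory.
Import VectorInternalTheory.
Local Open Scope ring_scope.

(** The Lie algebra is governed by one commutative product on its derived algebra A. Simplicity of
    [J] splits g as A + JA ([derived_decomposition], [derived_cap_J]), and then JA is abelian too
    ([lie_JJ]), so the only brackets left are [Jp, q]. As a product they are commutative by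
    integrability, associative by Jacobi, and simple because ideals of A correspond to [J]-invariant
    ideals of g. A finite-dimensional algebra of this kind has no zero divisors, hence is R or C
    ([simple_algebra_R_or_C]). Its multiplication table determines g together with [J]
    ([lie_decomposed], [holomorphically_isomorphic_coordinates]). *)

Lemma exists_quadratic_eigenvector (R : rcfType) (V : vectType R)
    (f : 'End(V)) :
  (0 < \dim {:V})%N ->
  exists (a b : R) (v : V), v != 0 /\
    f (f v - a *: v) - a *: (f v - a *: v) = - b ^+ 2 *: v.
Proof.
rewrite dimvf => dim_gt0.
pose M := lin1_mx (v2r \o f \o r2v).
pose toC := real_complex R.
have [[a b] /eigenvalueP[w wM w0]] :=
  eigenvalue_closed (map_mx toC M) dim_gt0.
(* Over the complex numbers [N] kills an eigenvector for a + ib. Its determinant is real, so [N]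
   also kills a nonzero real vector. *)
pose N := (M - a%:M) *m (M - a%:M) + (b ^+ 2)%:M.
have /det0P[v v0 vN] : \det N == 0.
  rewrite -(fmorph_eq0 toC) -det_map_mx; apply/det0P; exists w => //.
  rewrite /N map_mxD map_mxM map_mxB !map_scalar_mx mulmxDr mulmxA.
  rewrite !(mulmxBr w) wM !mul_mx_scalar -scalerBl -scalemxAl mulmxBr wM.
  rewrite mul_mx_scalar -scalerBl scalerA -scalerDl.
  apply/eqP; rewrite scaler_eq0 eq_complex /=; apply/orP; left.
  by apply/andP; split; apply/eqP; ring.
have vM u : r2v (u *m (M - a%:M)) = f (r2v u) - a *: r2v u.
  by rewrite mulmxBr mul_mx_scalar mul_rV_lin1 linearB linearZ /= v2rK.
exists a, b, (r2v v); split.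
  by rewrite -(inj_eq (@v2r_inj _ _)) r2vK linear0.
apply/eqP; rewrite -!vM scaleNr -addr_eq0; apply/eqP.
rewrite -linearZ -linearD -mul_mx_scalar -mulmxA -mulmxDr.
by rewrite -/N vN linear0.
Qed.

(** * Simple commutative associative real algebras *)

Section SimpleCommutativeAlgebra.
Variables (R : rcfType) (V : vectType R) (op : {bilinear V -> V -> V}).
Hypotheses (opC : commutative op) (opA : associative op).
Hypothesis op_simple : forall I : {vspace V},
  (forall x y, y \in I -> op x y \in I) -> I = 0%VS \/ I = fullv.
Hypothesis op_neq0 : exists x y, op x y != 0.

(** The annihilator of a nonzero [x] is an ideal, hence 0 or everything; the second case would make
    the whole product vanish. *)
Lemma simple_algebra_mul_eq0 x y : (op x y == 0) = (x == 0) || (y == 0).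
Proof.
apply/eqP/orP=> [xy0|[]/eqP->]; rewrite ?linear0l ?linear0r //.
have [|x0] := eqVneq x 0; [by left|right].
have annP t : reflect (op x t = 0) (t \in lker (linfun (op x))).
  by rewrite memv_ker lfunE; exact: eqP.
have [|I0|IT] := op_simple (I := lker (linfun (op x))) _.
- move=> s t /annP xt0; apply/annP.
  by rewrite opA [op x s]opC -opA xt0 linear0r.
- by move/annP: xy0; rewrite I0 memv0.
(* As [op x] vanishes, the line spanned by [x] is an ideal. *)
have x_ann t : op x t = 0 by apply/annP; rewrite IT memvf.
have [|x_0|xT] := op_simple (I := <[x]>%VS) _.
- by move=> s t /vlineP[k ->]; rewrite linearZr_LR opC x_ann scaler0 mem0v.
- by have := memv_line x; rewrite x_0 memv0 (negPf x0).
have [z [t]] := op_neq0.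
have : z \in <[x]>%VS by rewrite xT memvf.
by case/vlineP=> k ->; rewrite linearZl_LR x_ann scaler0 eqxx.
Qed.

(** Multiplication by a nonzero [a] is injective, hence bijective in finite dimension. The preimage
    of [a] is the unit, since [a] can be cancelled. *)
Lemma simple_algebra_unit : exists2 e, e != 0 & forall x, op e x = x.
Proof.
have [a [b ab0]] := op_neq0.
have a0 : a != 0 by apply: contraNneq ab0 => ->; rewrite linear0l.
have aK0 : lker (linfun (op a)) == 0%VS.
  apply/eqP/vspaceP=> x.
  by rewrite memv_ker lfunE /= simple_algebra_mul_eq0 (negPf a0) memv0.
pose e := (linfun (op a))^-1%VF a.
have ae : op a e = a.
  by rewrite -[LHS](lfunE (op a)) lker0_lfunVK.
exists e => [|x]; first by apply: contraNneq a0 => e0; rewrite -ae e0 linear0r.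
apply/eqP; rewrite -subr_eq0; have /eqP : op a (op e x - x) = 0.
  by rewrite linearBr opA ae subrr.
by rewrite simple_algebra_mul_eq0 (negPf a0).
Qed.

Lemma simple_algebra_R_or_C :
  exists e, [/\ e != 0, forall x, op e x = x &
    (forall x, exists a, x = a *: e) \/
    exists2 y, op y y = - e & forall x, exists a b, x = a *: e + b *: y].
Proof.
have [e e0 op1] := simple_algebra_unit.
exists e; split=> //.
have dim_gt0 : (0 < \dim {:V})%N.
  rewrite lt0n dimv_eq0; apply: contraNneq e0 => V0.
  by rewrite -memv0 -V0 memvf.
(* [(x - a e)^2 + b^2 e] is a zero divisor when [a + ib] is an eigenvalue of *)
(* multiplication by [x].                                                     *)
have quad x : exists a b, op (x - a *: e) (x - a *: e) = - b ^+ 2 *: e.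
  have [a [b [v [v0]]]] := exists_quadratic_eigenvector (linfun (op x)) dim_gt0.
  rewrite !lfunE /= => xxv; exists a, b; apply/eqP; rewrite -subr_eq0.
  have xE t : op (x - a *: e) t = op x t - a *: t.
    by rewrite linearBl linearZl_LR op1.
  suff : op (op (x - a *: e) (x - a *: e) - - b ^+ 2 *: e) v == 0.
    by rewrite simple_algebra_mul_eq0 (negPf v0) orbF.
  by rewrite linearBl linearZl_LR op1 -opA !xE xxv subrr.
have [/subvP eT|/subvPn[x _ xNe]] :=
  boolP (fullv <= <[e]>)%VS; [left=> x|right].
  by have /vlineP[k ->] := eT x (memvf x); exists k.
have [a [b xab]] := quad x.
(* With [b = 0] the element [x - a *: e] would square to 0, hence vanish, putting [x] on the line of
   [e]. *)
have b0 : b != 0.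
  apply: contraNneq xNe => b0; apply/vlineP; exists a; apply/eqP.
  rewrite -subr_eq0 -[_ == 0]orbb -simple_algebra_mul_eq0 xab b0.
  by rewrite expr0n oppr0 scale0r.
pose y := b^-1 *: (x - a *: e).
have yy : op y y = - e.
  rewrite linearZl_LR linearZr_LR xab !scalerA !mulrN scaleNr expr2 mulrA.
  by rewrite mulfVK // mulVf // scale1r.
exists y => // z.
have [c [d]] := quad z; move uE: (z - c *: e) => u uu.
(* [u^2 = (d y)^2], so [u = d y] or [u = - d y]. *)
have : op (u - d *: y) (u + d *: y) == 0.
  rewrite linearBl !linearDr uu [op _ u]opC addrKA.
  by rewrite linearZl_LR linearZr_LR yy scalerA -expr2 scalerN scaleNr subrr.
rewrite simple_algebra_mul_eq0 subr_eq0 addr_eq0 -uE !subr_eq => /orP[]/eqP->.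
  by exists c, d; rewrite addrC.
by exists c, (- d); rewrite scaleNr addrC.
Qed.

End SimpleCommutativeAlgebra.

(** * The product [Jp, q] on the derived algebra *)

Section DerivedSubalgebraProduct.
Variables (R : realType) (g : lieAlgType R) (J : 'End(g)).
Hypothesis g_2solv : two_step_solvable g.
Hypothesis J_simple : simple_complex_structure J.

Local Notation A := (derived_subalgebra g).

Let JJ x : J (J x) = - x.
Proof. by case: J_simple => [[]]. Qed.

Let lieC x y : [lie x, y] = - [lie y, x] :> g.
Proof.
have := lie_alternating (x + y); rewrite linearDl !linearDr /=.
by rewrite !lie_alternating add0r addr0 => /eqP; rewrite addr_eq0 => /eqP.
Qed.

Let nijenhuis x y :
  [lie J x, J y] = [lie x, y] + J [lie J x, y] + J [lie x, J y].
Proof.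
by have [[_ /(_ x y)/eqP]] := J_simple; rewrite subr_eq0 => /eqP.
Qed.

Let mem_derived x y : [lie x, y] \in A.
Proof. by apply: memv_lie; apply: memvf. Qed.

Let derived_abelian x y : x \in A -> y \in A -> [lie x, y] = 0.
Proof.
by move=> Ax Ay; apply/eqP; rewrite -memv0 -g_2solv memv_lie.
Qed.

Lemma derived_decomposition x :
  exists p q : subvs_of A, x = vsval p + J (vsval q).
Proof.
have [_ g_nonabelian J_ideals] := J_simple.
suff [sum0|sumT] : (A + J @: A)%VS = 0%VS \/ (A + J @: A)%VS = fullv.
- case: g_nonabelian => y z; apply/eqP; rewrite -memv0 -sum0.
  exact: subvP (addvSl _ _) _ (mem_derived _ _).
- have /memv_addP[y Ay [_ /memv_imgP[z Az ->] ->]] : x \in (A + J @: A)%VS.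
    by rewrite sumT memvf.
  by exists (vsproj A y), (vsproj A z); rewrite !vsprojK.
apply: J_ideals => [y z _|].
  exact: subvP (addvSl _ _) _ (mem_derived _ _).
rewrite limgD addvC addvS // -limg_comp; apply/subvP=> _ /memv_imgP[x' Ax' ->].
by rewrite comp_lfunE JJ rpredN.
Qed.

(** The intersection of A and JA is a [J]-invariant ideal: for z, u, Ju in A, integrability reduces
    to [Jz, Ju] = J[Jz, u], so J[Jz, u] stays in A. It cannot be all of g, since A is abelian and g
    is not. *)
Lemma derived_cap_J (p q : subvs_of A) : vsval p + J (vsval q) = 0 -> p = 0.
Proof.
have [_ g_nonabelian J_ideals] := J_simple.
have BP x : reflect (x \in A /\ J x \in A) (x \in (A :&: J @: A)%VS).
  apply: (iffP memv_capP) => [] [Ax].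
    by case/memv_imgP=> y Ay xy; split=> //; rewrite xy JJ rpredN.
  move=> AJx; split=> //; apply/memv_imgP.
  by exists (- J x); rewrite ?rpredN // linearN /= JJ opprK.
suff [B0|BT] : (A :&: J @: A)%VS = 0%VS \/ (A :&: J @: A)%VS = fullv.
- move/eqP; rewrite addr_eq0 => /eqP pq.
  apply/subvs_inj/eqP; rewrite linear0 -memv0 -B0.
  by apply/BP; split; rewrite ?subvsP // pq linearN /= JJ opprK subvsP.
- case: g_nonabelian => x y; apply: derived_abelian.
    by have /BP[] : x \in (A :&: J @: A)%VS by rewrite BT memvf.
  by have /BP[] : y \in (A :&: J @: A)%VS by rewrite BT memvf.
apply: J_ideals => [x u /BP[Au AJu]|].
  have [y [z ->]] := derived_decomposition x.
  rewrite linearDl /= (derived_abelian _ Au) ?subvsP // add0r.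
  apply/BP; split=> //.
  have := nijenhuis (vsval z) u.
  rewrite !(derived_abelian (subvsP z)) // linear0 addr0 add0r => <-.
  exact: mem_derived.
apply/subvP=> _ /memv_imgP[x /BP[Ax AJx] ->].
by apply/BP; rewrite JJ rpredN.
Qed.

Definition derived_product (p q : subvs_of A) : subvs_of A :=
  vsproj A [lie J (vsval p), vsval q].

Local Notation op := derived_product.

Lemma derived_product_bilinear : bilinear_for *:%R *:%R derived_product.
Proof.
split=> p a q r; rewrite /derived_product.
  by rewrite !linearP linearPl /= linearP.
by rewrite linearP linearPr linearP.
Qed.

HB.instance Definition _ := bilinear_isBilinear.Build R (subvs_of A)
  (subvs_of A) (subvs_of A) _ _ derived_product derived_product_bilinear.

Let opE p q : [lie J (vsval p), vsval q] = vsval (op p q).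
Proof. by rewrite vsprojK. Qed.

Let valD (p q : subvs_of A) : [lie vsval p, vsval q] = 0.
Proof. by apply: derived_abelian; apply: subvsP. Qed.

(** Integrability gives [Jp, Jq] = J(p.q - q.p), which lies in both A and JA, hence is 0. *)
Lemma derived_productC : commutative derived_product.
Proof.
move=> p q; apply/eqP; rewrite -subr_eq0; apply/eqP.
pose w := vsproj A [lie J (vsval p), J (vsval q)].
have wE : vsval w = J (vsval (op p q - op q p)).
  rewrite vsprojK // nijenhuis valD add0r [[lie vsval p, _]]lieC !opE.
  by rewrite -linearD -linearB.
by apply: (@derived_cap_J _ w); rewrite wE JJ subrr.
Qed.

Lemma lie_JJ (p q : subvs_of A) : [lie J (vsval p), J (vsval q)] = 0.
Proof.
rewrite nijenhuis valD add0r [[lie vsval p, _]]lieC !opE derived_productC.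
by rewrite linearN subrr.
Qed.

(** As Jp and Jr commute, Jacobi on Jp, Jr, q reads p.(r.q) = r.(p.q), which is associativity up to
    commutativity. *)
Lemma derived_productA : associative derived_product.
Proof.
move=> p q r; apply: subvs_inj.
rewrite [op q r]derived_productC [RHS](congr1 vsval (derived_productC _ _)).
have := lie_jacobi (J (vsval p)) (J (vsval r)) (vsval q).
rewrite lie_JJ linear0r addr0 [[lie vsval q, _]]lieC linearNr /= !opE.
by move/eqP; rewrite subr_eq0 => /eqP.
Qed.

Lemma lie_decomposed (p q p' q' : subvs_of A) :
  [lie vsval p + J (vsval q), vsval p' + J (vsval q')] =
  vsval (op q p' - op q' p).
Proof.
rewrite linearDl !linearDr /= valD lie_JJ addr0 add0r.
by rewrite [[lie vsval p, _]]lieC !opE addrC.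
Qed.

Lemma derived_product_simple (I : {vspace subvs_of A}) :
  (forall p q, q \in I -> op p q \in I) -> I = 0%VS \/ I = fullv.
Proof.
have [_ _ J_ideals] := J_simple.
move=> opI; pose K := (linfun vsval @: I)%VS.
have KP x : reflect
    (exists p q, [/\ p \in I, q \in I & x = vsval p + J (vsval q)])
    (x \in (K + J @: K)%VS).
  apply: (iffP memv_addP).
    move=> [_ /memv_imgP[p Ip ->] [_ /memv_imgP[_ /memv_imgP[q Iq ->] ->] ->]].
    by exists p, q; rewrite !lfunE.
  move=> [p [q [Ip Iq ->]]].
  exists (vsval p); first by rewrite -(lfunE vsval) memv_img.
  by exists (J (vsval q)); first by rewrite -(lfunE vsval) !memv_img.
(* [I] is recovered as the intersection of A with I + JI, so I + JI being 0 or g forces [I] to be 0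
   or A. *)
have KI p : vsval p \in (K + J @: K)%VS -> p \in I.
  case/KP=> q [r [Iq _ pqr]].
  suff /eqP : q - p = 0 by rewrite subr_eq0 => /eqP<-.
  by apply: (@derived_cap_J _ r); rewrite linearB /= pqr addrAC subrr.
have IK p : p \in I -> vsval p \in (K + J @: K)%VS.
  by move=> Ip; apply/KP; exists p, 0; rewrite mem0v !linear0 addr0.
have [x y /KP[r [s [Ir Is ->]]]||K0|KT] := J_ideals (K + J @: K)%VS.
- have [p [q ->]] := derived_decomposition x.
  rewrite lie_decomposed; apply: IK.
  by rewrite [op s p]derived_productC rpredB // opI.
- apply/subvP=> _ /memv_imgP[_ /KP[p [q [Ip Iq ->]]] ->]; apply/KP.
  by exists (- q), p; rewrite rpredN linearD /= JJ addrC.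
- left; apply/vspaceP=> p; apply/idP/idP=> [/IK|].
    by rewrite K0 !memv0 -(inj_eq (@subvs_inj _ _ _)) linear0.
  by rewrite memv0 => /eqP->; apply: mem0v.
by right; apply/vspaceP=> p; rewrite memvf KI // KT memvf.
Qed.

Lemma derived_product_neq0 : exists p q, op p q != 0.
Proof.
have [_ g_nonabelian _] := J_simple; apply: contrapT => op0.
have {}op0 p q : op p q = 0.
  by apply/eqP; apply: contrapT => /negP pq0; apply: op0; exists p, q.
case: g_nonabelian => x y.
have [p [q ->]] := derived_decomposition x.
have [p' [q' ->]] := derived_decomposition y.
by rewrite lie_decomposed !op0 subrr.
Qed.

(** The hypotheses say that [u] maps to [(c u, d u)] bijectively onto pairs (p, q) standing for p +
    Jq, with [J] and the bracket transported. The isomorphism sought starts from g, hence the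
    inverse of [f]. *)
Lemma holomorphically_isomorphic_coordinates (h : lieAlgType R) (Jh : 'End(h))
    (c d : 'Hom(h, subvs_of A)) :
  (forall u, c u = 0 -> d u = 0 -> u = 0) ->
  (forall p q, exists u, c u = p /\ d u = q) ->
  (forall u, c (Jh u) = - d u) -> (forall u, d (Jh u) = c u) ->
  (forall u v, c [lie u, v] = op (d u) (c v) - op (d v) (c u)) ->
  (forall u v, d [lie u, v] = 0) ->
  holomorphically_isomorphic J Jh.
Proof.
move=> cd_inj cd_surj cJ dJ c_lie d_lie.
pose f := ((linfun vsval \o c) + (J \o (linfun vsval \o d)))%VF.
have fE u : f u = vsval (c u) + J (vsval (d u)).
  by rewrite add_lfunE !comp_lfunE !lfunE.
have f_ker0 : lker f == 0%VS.
  apply/eqP/vspaceP=> u; rewrite memv_ker memv0 fE; apply/eqP/eqP=> [fu0|->].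
    have cu0 := derived_cap_J fu0; apply: cd_inj => //; apply: subvs_inj.
    have : J (J (vsval (d u))) = J 0 by rewrite -fu0 cu0 add0r.
    by rewrite JJ !linear0 => /eqP; rewrite oppr_eq0 => /eqP.
  by rewrite !linear0 addr0.
have f_surj x : exists u, f u = x.
  have [p [q ->]] := derived_decomposition x.
  by have [u [<- <-]] := cd_surj p q; exists u; rewrite fE.
have fK := lker0_lfunK f_ker0.
have fVK : cancel f^-1%VF f by move=> x; have [u <-] := f_surj x; rewrite fK.
exists f^-1%VF; split=> [|x y|x]; first by exists f.
  have [u <-] := f_surj x; have [v <-] := f_surj y; rewrite !fK.
  apply: (can_inj fK); rewrite fVK.
  by rewrite !fE c_lie d_lie lie_decomposed !linear0 addr0.
have [u <-] := f_surj x; rewrite fK; apply: (can_inj fK).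
by rewrite fVK !fE cJ dJ linearD /= JJ addrC.
Qed.

End DerivedSubalgebraProduct.

(** * Coordinates on aff(R) and aff(C), and the classification *)

Definition two_entries_comb (R : nzRingType) (V : lmodType R) n (i j : 'I_n)
    (x y : V) (u : 'rV[R]_n) : V := u 0 i *: x + u 0 j *: y.

Lemma two_entries_comb_linear (R : nzRingType) (V : lmodType R) n (i j : 'I_n)
  (x y : V) : linear (two_entries_comb i j x y).
Proof.
move=> k u v; rewrite /two_entries_comb !mxE !scalerDl -!scalerA.
by rewrite scalerDr addrACA.
Qed.

HB.instance Definition _ (R : nzRingType) (V : lmodType R) n i j x y :=
  GRing.isLinear.Build R 'rV[R]_n V _ (two_entries_comb i j x y)
    (@two_entries_comb_linear R V n i j x y).

Lemma affR_J_entries (R : realType) (u : affR R) :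
  affR_J R u 0 0 = - u 0 1 /\ affR_J R u 0 1 = u 0 0.
Proof.
rewrite lfunE /= !mxE !big_ord_recl !big_ord0 !mxE /=.
have -> : lift ord0 ord0 = 1 :> 'I_2 by exact/val_inj.
by split; ring.
Qed.

Lemma affC_J_entries (R : realType) (u : affC R) :
  [/\ affC_J R u 0 0 = - u 0 1, affC_J R u 0 1 = u 0 0,
      affC_J R u 0 2 = - u 0 3 & affC_J R u 0 3 = u 0 2].
Proof.
rewrite lfunE /= !mxE !big_ord_recl !big_ord0 !mxE /=.
have -> : lift ord0 ord0 = 1 :> 'I_4 by exact/val_inj.
have -> : lift ord0 (lift ord0 ord0) = 2 :> 'I_4 by exact/val_inj.
have -> : lift ord0 (lift ord0 (lift ord0 ord0)) = 3 :> 'I_4 by exact/val_inj.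
by split; ring.
Qed.

Theorem theorem3p9 (R : realType) (g : lieAlgType R) (J : 'End(g)) :
  two_step_solvable g -> simple_complex_structure J ->
  holomorphically_isomorphic J (affR_J R) \/
  holomorphically_isomorphic J (affC_J R).
Proof.
move=> g_2solv J_simple.
have opC := derived_productC g_2solv J_simple.
have opA := derived_productA g_2solv J_simple.
have [e [e0 op1 eT]] :=
  simple_algebra_R_or_C opC opA (derived_product_simple g_2solv J_simple)
    (derived_product_neq0 g_2solv J_simple).
have op1r x : derived_product J x e = x by rewrite opC op1.
case: eT => [eT|[y yy yT]]; [left|right].
  (* Here A is the line of [e]; X corresponds to e and JX to Je. *)
  pose c i : 'Hom(affR R, subvs_of (derived_subalgebra g)) :=
    linfun (two_entries_comb i i e 0).
  have cE i u : c i u = u 0 i *: e.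
    by rewrite lfunE /= /two_entries_comb scaler0 addr0.
  apply: (holomorphically_isomorphic_coordinates g_2solv J_simple
    (c := c 0) (d := c 1)).
  - move=> u; rewrite !cE => /eqP+ /eqP; rewrite !scaler_eq0 (negPf e0) !orbF.
    move=> /eqP u0 /eqP u1; apply/rowP=> i; rewrite mxE.
    by case: i => [[|[|//]] i_lt]; [rewrite -[RHS]u0 | rewrite -[RHS]u1];
      congr (u _ _); apply: val_inj.
  - move=> p q; have [a ->] := eT p; have [b ->] := eT q.
    exists (a *: affR_X R + b *: affR_JX R).
    by rewrite !cE !mxE /= ?(mulr1, mulr0, addr0, add0r).
  - by move=> u; rewrite !cE; have [-> _] := affR_J_entries u; rewrite scaleNr.
  - by move=> u; rewrite !cE; have [_ ->] := affR_J_entries u.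
  - move=> u v; rewrite !cE !(linearZl_LR, linearZr_LR) /= op1 !scalerA.
    by rewrite -scalerBl !mxE; congr (_ *: _) => /=; ring.
  - by move=> u v; rewrite !cE !mxE /= mulr0 scale0r.
(* Here A is a copy of C with [y] as imaginary unit; X, Y correspond to e, y, so entries 0, 2 give
   the A part and 1, 3 the JA part. *)
pose c i j : 'Hom(affC R, subvs_of (derived_subalgebra g)) :=
  linfun (two_entries_comb i j e y).
have cE i j u : c i j u = u 0 i *: e + u 0 j *: y by rewrite lfunE.
have mulE a b a' b' : derived_product J (a *: e + b *: y) (a' *: e + b' *: y)
    = (a * a' - b * b') *: e + (a * b' + b * a') *: y.
  rewrite !(linearDl, linearDr) /= !(linearZl_LR, linearZr_LR) /= !op1 op1r yy.
  rewrite !scalerN !scalerA scalerBl scalerDl -!addrA.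
  by congr (_ + _); rewrite addrA addrC.
(* Multiplying by the conjugate [a *: e - b *: y] gives [(a ^+ 2 + b ^+ 2) *: e]. *)
have ey_free a b : a *: e + b *: y = 0 -> a = 0 /\ b = 0.
  move=> ab0; have /eqP := mulE a b a (- b).
  rewrite ab0 linear0l mulrN mulrN opprK [b * a]mulrC addNr scale0r addr0.
  rewrite eq_sym scaler_eq0 (negPf e0) orbF -!expr2 paddr_eq0 ?sqr_ge0 //.
  by rewrite !sqrf_eq0 => /andP[/eqP-> /eqP->].
apply: (holomorphically_isomorphic_coordinates g_2solv J_simple
  (c := c 0 2) (d := c 1 3)).
- move=> u; rewrite !cE => /ey_free[u0 u2] /ey_free[u1 u3].
  apply/rowP=> i; rewrite mxE.
  by case: i => [[|[|[|[|//]]]] i_lt];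
    [rewrite -[RHS]u0 | rewrite -[RHS]u1 | rewrite -[RHS]u2 | rewrite -[RHS]u3];
      congr (u _ _); apply: val_inj.
- move=> p q; have [a [a' ->]] := yT p; have [b [b' ->]] := yT q.
  exists (a *: affC_X R + b *: affC_JX R + a' *: affC_Y R + b' *: affC_JY R).
  by rewrite !cE !mxE /= ?(mulr1, mulr0, addr0, add0r).
- move=> u; rewrite !cE; have [-> _ -> _] := affC_J_entries u.
  by rewrite !scaleNr opprD.
- by move=> u; rewrite !cE; have [_ -> _ ->] := affC_J_entries u.
- move=> u v; rewrite !cE.
  rewrite !mulE opprD addrACA -!scalerBl !mxE /=.
  by congr (_ *: _ + _ *: _); ring.
- by move=> u v; rewrite !cE !mxE /= ?(mulr0, addr0, scale0r).
Qed.
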